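(* Let $\mathbb P_1,\dots,\mathbb P_n\in\mathcal P$ and $h_1,\dots,h_n\in\mathcal H^{\rm BV}$ be given, and let $X\in\mathcal X$ admit a density under each of $\mathbb P_1,\dots,\mathbb P_n$. Then there exist a probability measure $\mathbb P\in\mathcal P$ and distortion functions $g_1,\dots,g_n\in\mathcal H^{\rm BV}$ such that an allocation $(X_1,\dots,X_n)\in\mathbb A_n^+(X)$ is Pareto optimal in $\mathbb A_n^+(X)$ for $(\rho_{h_1}^{\mathbb P_1},\dots,\rho_{h_n}^{\mathbb P_n})$ if and only if it is Pareto optimal in $\mathbb A_n^+(X)$ for $(\rho_{g_1}^{\mathbb P},\dots,\rho_{g_n}^{\mathbb P})$.
   Context: $(\Omega,\mathcal F)$ is a measurable space admitting atomless probability measures, and $\mathcal P$ is the set of atomless probability measures on $(\Omega,\mathcal F)$. $\mathcal X$ is the set of bounded random variables on $(\Omega,\mathcal F)$. $\mathcal H^{\rm BV}$ is the set of functions $h:[0,1]\to\mathbb R$ of bounded variation with $h(0)=0$. For $h\in\mathcal H^{\rm BV}$ and a probability measure $\mathbb Q$, $$\rho_h^{\mathbb Q}(X)=\int_0^\infty h(\mathbb Q(X>x))\,dx+\int_{-\infty}^0\big(h(\mathbb Q(X>x))-h(1)\big)\,dx .$$ Random variables $X_1,\dots,X_n$ are comonotonic if there are increasing (non-strictly) functions $f_i:\mathbb R\to\mathbb R$ and a random variable $Z$ with $X_i=f_i(Z)$ almost surely for all $i$; here almost-sure statements are understood under all of $\mathbb P_1,\dots,\mathbb P_n$. $\mathbb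 A_n^+(X)$ is the set of comonotonic $(X_1,\dots,X_n)\in\mathcal X^n$ with $\sum_{i=1}^nX_i=X$. For preferences $\rho_1,\dots,\rho_n$ (smaller is better), $(X_1,\dots,X_n)\in\mathbb A_n^+(X)$ is Pareto optimal in $\mathbb A_n^+(X)$ if for any $(Y_1,\dots,Y_n)\in\mathbb A_n^+(X)$ with $\rho_i(Y_i)\le\rho_i(X_i)$ for all $i$, one has $\rho_i(Y_i)=\rho_i(X_i)$ for all $i$. *)

(* Defs.v *)
From HB Require Import structures.
From mathcomp Require Import all_boot all_order all_algebra.
From mathcomp Require Import all_classical all_reals all_analysis.

Set Implicit Arguments.
Unset Strict Implicit.
Unset Printing Implicit Defensive.

Import Order.TTheory GRing.Theory Num.Theory.
Import numFieldNormedType.Exports.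

Local Open Scope classical_set_scope.
Local Open Scope ring_scope.

Definition atomless d (T : measurableType d) (R : realType)
    (P : probability T R) : Prop :=
  forall A : set T, measurable A -> (0 < P A)%E ->
    exists B : set T, [/\ measurable B, B `<=` A, (0 < P B)%E & (P B < P A)%E].

(* A function on [0,1] is encoded as a total function [R -> R], of which only
   the restriction to [0,1] matters. *)
Definition HBV (R : realType) (h : R -> R) : Prop :=
  bounded_variation 0 1 h /\ h 0 = 0.

(* For [h] in [HBV] and [X] bounded, both integrands are bounded, measurable and
   vanish outside a bounded interval, so the real-valued integrals [Rintegral]
   (which default to 0 on infinite or undefined values) are genuine ones. *)
Definition rho d (T : measurableType d) (R : realType)
    (h : R -> R) (Q : probability T R) (X : T -> R) : R :=
  let S x := fine (Q [set w | x < X w]) in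
  \int[lebesgue_measure]_(x in `[0, +oo[) h (S x)
  + \int[lebesgue_measure]_(x in `]-oo, 0]) (h (S x) - h 1).

Definition admits_density d (T : measurableType d) (R : realType)
    (Q : probability T R) (X : {mfun T >-> R}) : Prop :=
  exists f : R -> R,
    [/\ measurable_fun setT f, forall x, 0 <= f x &
        forall A : set R, measurable A ->
          distribution Q X A = (\int[lebesgue_measure]_(x in A) (f x)%:E)%E].

(* "Almost surely" means almost surely under every [P j]. *)
Definition comonotonic d (T : measurableType d) (R : realType) (n : nat)
    (P : 'I_n -> probability T R) (Xs : 'I_n -> {mfun T >-> R}) : Prop :=
  exists (f : 'I_n -> R -> R) (Z : {mfun T >-> R}),
    (forall i x y, x <= y -> f i x <= f i y) /\
    (forall i j, {ae P j, forall w, Xs i w = f i (Z w)}).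

(* The constraint on the sum is an identity of functions on [T]. *)
Definition comonotonic_allocations d (T : measurableType d) (R : realType)
    (n : nat) (P : 'I_n -> probability T R) (X : {mfun T >-> R}) :
    set ('I_n -> {mfun T >-> R}) :=
  [set Xs : 'I_n -> {mfun T >-> R} | [/\ forall i, bounded_fun (Xs i : T -> R),
                comonotonic P Xs &
                forall w, \sum_(i < n) Xs i w = X w]].

Definition pareto_optimal d (T : measurableType d) (R : realType) (n : nat)
    (A : set ('I_n -> {mfun T >-> R})) (r : 'I_n -> (T -> R) -> R)
    (Xs : 'I_n -> {mfun T >-> R}) : Prop :=
  A Xs /\
  forall Ys, A Ys -> (forall i, r i (Ys i) <= r i (Xs i)) ->
    forall i, r i (Ys i) = r i (Xs i).

(* Main.v *)
(* Let P be the average of the Ps i; it is atomless and has the common null sets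
   of the Ps i.  In a comonotonic allocation of X each component is almost surely
   an increasing function of X, and X has no atoms in its law, so every event
   {Xs i > x} coincides, up to a null set of all the Ps j, with some {X > y}.
   By equivalence, Ps i {X > y} is an increasing function phi i of P {X > y};
   hence gs i := hs i \o phi i gives hs i (Ps i {Xs i > x}) = gs i (P {Xs i > x})
   for all x, and the two preferences take the same values on all comonotonic
   allocations. *)
Require Import Defs.
From HB Require Import structures.
From mathcomp Require Import all_boot all_order all_algebra.
From mathcomp Require Import all_classical all_reals all_analysis.
Import Order.TTheory GRing.Theory Num.Theory.
Import numFieldNormedType.Exports.
Local Open Scope classical_set_scope.
Local Open Scope ring_scope.

(** Jordan decomposition: [h] is a difference of two nondecreasing functions on [[a, b]], and each
    stays nondecreasing after composition with [phi]. Since [phi] maps every real into [[a, b]], the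
    decomposition of [h \o phi] is an identity of total functions. *)
Lemma bounded_variation_comp_homo (R : realType) (a b c d : R) (h phi : R -> R) :
  c < d -> bounded_variation a b h -> (forall p, phi p \in `[a, b]) ->
  {in `[c, d] &, {homo phi : p q / p <= q}} ->
  bounded_variation c d (h \o phi).
Proof.
move=> cd bvh phiab phi_homo.
have -> : h \o phi = (fine \o neg_tv a (\- h) \o phi)
                     \+ (\- (fine \o neg_tv a h \o phi)).
  by apply/funext => p /=; rewrite (bounded_variation_pos_neg_tvE bvh).
have bv_tv k : bounded_variation a b k ->
    bounded_variation c d (fine \o neg_tv a k \o phi).
  move=> bvk; apply: nondecreasing_bounded_variation => p q pcd qcd pq /=.
  by apply: (fine_neg_tv_nondecreasing bvk) => //; exact: phi_homo.
apply: bounded_variationD => //; last exact/bounded_variationN/bv_tv.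
exact/bv_tv/bounded_variationN.
Qed.

Lemma equivalent_mixture d (T : measurableType d) (R : realType) (n : nat)
    (Ps : 'I_n.+1 -> probability T R) :
  exists P : probability T R,
    (forall A, P A = 0%E <-> forall i, Ps i A = 0%E) /\
    (forall A B, (forall i, Ps i A = Ps i B) -> P A = P B).
Proof.
pose mu : measure T R := msum (fun k => Ps (inord k)) n.+1.
pose c : R := n.+1%:R^-1.
have c0 : 0 < c by rewrite invr_gt0 ltr0n.
have muE A : mu A = (\sum_i Ps i A)%E.
  by apply: eq_bigr => i _; rewrite inord_val.
have muT : mu setT = n.+1%:R%:E.
  rewrite muE (eq_bigr (fun=> 1%E)) => [|i _]; last exact: probability_setT.
  by rewrite sumEFin sumr_const card_ord.
(* [Ps ord0] is the fallback of [mnormalize] for zero or infinite mass; [muT] excludes both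
   cases. *)
pose P : probability T R := mnormalize mu (Ps ord0).
have PE A : P A = (c%:E * \sum_i Ps i A)%E.
  by rewrite /P /= /mnormalize muT /= eqe pnatr_eq0/= muE muleC.
exists P; split=> [A|A B AB]; rewrite !PE; last first.
  by under eq_bigr do rewrite AB.
split=> [/eqP|A0]; last by rewrite big1 ?mule0.
rewrite mule_eq0 eqe gt_eqF//= seq_psume_eq0 => [/allP sum0 i|//].
by apply/eqP/sum0; rewrite mem_index_enum.
Qed.

(** The difference of the nested sets is [P]-null, hence [Q]-null. *)
Lemma dominated_eq_measure d (T : measurableType d) (R : realType)
    (P Q : probability T R) (A B : set T) :
  (forall C, P C = 0%E -> Q C = 0%E) ->
  measurable A -> measurable B -> B `<=` A -> P A = P B -> Q A = Q B.
Proof.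
move=> PQ mA mB BA PAB.
have AB : A = B `|` (A `\` B) by rewrite setDUK.
have mAB : measurable (A `\` B) by exact: measurableD.
rewrite AB measureU0//; apply: PQ.
rewrite measureD//= ?(setIidr BA) ?PAB ?subee ?ltey_eq ?fin_num_measure//.
Qed.

Lemma eq_measure_ae d (T : measurableType d) (R : realType)
    (mu : {measure set T -> \bar R}) (A B : set T) :
  measurable A -> measurable B -> {ae mu, forall w, A w <-> B w} -> mu A = mu B.
Proof.
move=> mA mB [M [mM M0 AB]].
have AM : A `|` M = B `|` M.
  apply/seteqP; split=> w [] Cw; [|by right| |by right];
  have [?|nMw] := pselect (M w); try (by right); left;
  have /(_ w) := AB; rewrite /= => H;
  (have {H} : A w <-> B w by apply: contrapT => /H); tauto.
by rewrite -(measureU0 mA mM M0) AM (measureU0 mB mM M0).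
Qed.

(** A set charged by [P] is charged by some [Ps i]. A subset splitting it for [Ps i] also splits it
    for [P]: equal [P]-masses would force equal [Ps i]-masses by domination. *)
Lemma atomless_mixture d (T : measurableType d) (R : realType) (n : nat)
    (Ps : 'I_n -> probability T R) (P : probability T R) :
  (forall A, P A = 0%E <-> forall i, Ps i A = 0%E) ->
  (forall i, atomless (Ps i)) -> atomless P.
Proof.
move=> P0 Psa A mA PA.
have [i Ai] : exists i, Ps i A <> 0%E.
  by apply/existsNP => /P0 A0; rewrite A0 ltxx in PA.
have /(Psa i A mA) [B [mB BA B0 BltA]] : (0 < Ps i A)%E.
  by rewrite lt0e measure_ge0 andbT; apply/eqP.
exists B; split => //.
  rewrite lt0e measure_ge0 andbT; apply/eqP => /P0 /(_ i) Bi0.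
  by rewrite Bi0 ltxx in B0.
rewrite lt_neqAle le_measure ?inE// andbT; apply/eqP => PBA.
move: BltA; rewrite (dominated_eq_measure _ _ _ P _ A B) ?ltxx//.
by move=> C /P0 /(_ i).
Qed.

Lemma bounded_fun_norm_le (T : Type) (R : realType) (X : T -> R) :
  bounded_fun X -> exists M, forall w, `|X w| <= M.
Proof.
move=> [M [_ /(_ (M + 1))]]; rewrite ltrDl ltr01 => /(_ isT) XM.
by exists (M + 1) => w; exact: XM.
Qed.

Lemma measurable_superlevel d (T : measurableType d) (R : realType)
    (X : {mfun T >-> R}) (y : R) : measurable [set w | y < X w].
Proof.
have -> : [set w | y < X w] = X @^-1` `]y, +oo[.
  by apply/seteqP; split=> w /=; rewrite in_itv/= andbT.
exact: measurable_funPTI.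
Qed.

Lemma density_level_null d (T : measurableType d) (R : realType)
    (Q : probability T R) (X : {mfun T >-> R}) (y : R) :
  admits_density Q X -> Q [set w | X w = y] = 0%E.
Proof.
move=> [f [mf f0 /(_ [set y] (measurable_set1 y))]].
rewrite integral_set1 => <-; congr (Q _).
Qed.

(** Meant for the survival functions [S] and [F] of [X] under [P] and under one [Ps i]. The level
    [y1] keeps the sets defining [phi p] nonempty for all [p >= 0]. *)
Lemma homo_factorization (R : realType) (S F : R -> R) (y1 : R) :
  (forall y, 0 <= F y <= 1) ->
  (forall y, 0 <= S y <= 1) ->
  {homo F : y z / y <= z >-> z <= y} ->
  (forall y z, S y = S z -> F y = F z) ->
  {homo S : y z / y <= z >-> z <= y} ->
  S y1 = 0 ->
  exists phi : R -> R, [/\ forall p, phi p \in `[0, 1],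
    {in `[0, 1] &, {homo phi : p q / p <= q}} &
    forall y, phi (S y) = F y].
Proof.
move=> F01 S01 Fmono FS Smono Sy1.
(* Taking suprema avoids inverting [S], so no continuity of [S] is needed. *)
pose E p := [set F y | y in [set y | S y <= p]].
have Eub p : ubound (E p) 1 by move=> _ [y _ <-]; case/andP: (F01 y).
have Ehas p : has_ubound (E p) by exists 1.
have En0 p : 0 <= p -> E p !=set0.
  by move=> p0; exists (F y1), y1 => //=; rewrite Sy1.
exists (fun p => sup (E p)); split.
- move=> p; rewrite in_itv/=; have [p0|p0] := leP 0 p.
    apply/andP; split; last by apply: ge_sup => //; exact: En0.
    apply: (@le_trans _ _ (F y1)); first by case/andP: (F01 y1).
    by apply: ub_le_sup => //; exists y1 => //=; rewrite Sy1.
  (* For [p < 0] the supremum of the empty set takes its default value [0], which lies in the unit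
     interval. *)
  suff -> : E p = set0 by rewrite sup0 lexx ler01.
  rewrite -subset0 => _ [y /= Sy _]; case/andP: (S01 y) => S0 _.
  by have := lt_le_trans p0 (le_trans S0 Sy); rewrite ltxx.
- move=> p q; rewrite !in_itv/= => /andP[p0 _] _ pq.
  apply: ge_sup; first exact: En0.
  move=> _ [y /= Sy <-]; apply: ub_le_sup => //; exists y => //=.
  exact: le_trans pq.
- move=> y; apply/eqP; rewrite eq_le; apply/andP; split.
    apply: ge_sup; first by exists (F y), y => /=.
    (* If [z] lies below [y], monotonicity of [S] turns [S z <= S y] into an equality, and [FS]
       applies. *)
    move=> _ [z /= Szy <-]; have [yz|/ltW zy] := leP y z; first exact: Fmono.
    rewrite (FS z y) //; apply/eqP; rewrite eq_le Szy; exact: Smono.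
  by apply: ub_le_sup => //; exists y => /=.
Qed.

Lemma comonotonic_survival d (T : measurableType d) (R : realType) (n : nat)
    (Ps : 'I_n -> probability T R) (X : {mfun T >-> R})
    (Xs : 'I_n -> {mfun T >-> R}) (i : 'I_n) (x : R) :
  bounded_fun (X : T -> R) -> (forall j, admits_density (Ps j) X) ->
  comonotonic_allocations Ps X Xs ->
  exists y, forall j, Ps j [set w | x < Xs i w] = Ps j [set w | y < X w].
Proof.
move=> bX Xd [_ [f [Z [fmono XsZ]]] XsX].
pose G := [set w | forall k, Xs k w = f k (Z w)].
have Gae j : {ae Ps j, forall w, G w} by apply: filter_forall => k; exact: XsZ.
(* When [Z w' < Z w] but [X w <= X w'], every summand decreases from [w] to [w']
   while their sum does not, so all summands agree. *)
have GX w w' : G w -> G w' -> X w <= X w' -> Xs i w <= Xs i w'.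
  move=> Gw Gw' XX; rewrite Gw Gw'.
  have [/fmono//|/ltW Z'Z] := leP (Z w) (Z w').
  have le_k k : Xs k w' <= Xs k w by rewrite Gw Gw'; exact: fmono.
  have := XX; rewrite -!XsX (bigD1 i)//= [leRHS](bigD1 i)//= -Gw -Gw' => sums.
  have: \sum_(k < n | k != i) Xs k w' <= \sum_(k < n | k != i) Xs k w by exact: ler_sum.
  by rewrite -(lerD2l (Xs i w)) => /le_trans/(_ sums); rewrite lerD2r.
have [M XM] := bounded_fun_norm_le _ _ _ bX.
have mA := measurable_superlevel _ _ _ (Xs i) x.
have mB y := measurable_superlevel _ _ _ X y.
pose U := [set w | G w /\ x < Xs i w].
have [U0|/set0P[w0 Uw0]] := eqVneq U set0.
  (* Here [Xs i] is almost surely at most [x], and [M] bounds [X], so both events are null. *)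
  exists M => j; apply: eq_measure_ae => //.
  apply: filterS (Gae j) => w Gw /=; split => [xw|Mw].
    by have : U w by []; rewrite U0.
  by have := lt_le_trans Mw (le_trans (ler_norm _) (XM w)); rewrite ltxx.
have lbU : has_lbound [set X w | w in U].
  by exists (- M) => _ [w _ <-]; have := XM w; rewrite ler_norml => /andP[].
(* By [GX], within [G] the set [U] contains every point whose [X]-value is at least that of a point
   of [U]. It is thus a superlevel set of [X], strict or not according to whether the infimum is
   attained; the two versions differ by a null level set. *)
exists (inf [set X w | w in U]) => j; apply: eq_measure_ae => //.
set y := inf _.
have Xy : {ae Ps j, forall w, X w <> y}.
  exists [set w | X w = y]; split.
  - exact: measurable_funPTI (measurable_set1 y).
  - exact: density_level_null.
  - by move=> w /= /contrapT.
apply: filterS2 (Gae j) Xy => w Gw Xwy /=; split => [xw|yw].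
  rewrite lt_neqAle eq_sym; apply/andP; split; first exact/eqP.
  by apply: ge_inf => //; exists w.
have [] := @inf_lt _ [set X w | w in U] (X w) _ yw; last first.
  move=> _ [w' [Gw' xw'] <-] /ltW /(GX _ _ Gw' Gw).
  exact: lt_le_trans.
by exists (X w0), w0.
Qed.

Theorem proposition10 (R : realType) (d : measure_display)
    (T : measurableType d)
    (hT : exists P0 : probability T R, atomless P0)
    (n : nat) (Ps : 'I_n -> probability T R) (hs : 'I_n -> R -> R)
    (X : {mfun T >-> R})
    (hPs : forall i, atomless (Ps i))
    (hhs : forall i, HBV (hs i))
    (hX : bounded_fun (X : T -> R))
    (hdens : forall i, admits_density (Ps i) X) :
  exists (P : probability T R) (gs : 'I_n -> R -> R),
    [/\ atomless P, (forall i, HBV (gs i)) &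
      forall Xs : 'I_n -> {mfun T >-> R},
        comonotonic_allocations Ps X Xs ->
        (pareto_optimal (comonotonic_allocations Ps X)
           (fun i => rho (hs i) (Ps i)) Xs <->
         pareto_optimal (comonotonic_allocations Ps X)
           (fun i => rho (gs i) P) Xs)].
Proof.
suff [P [gs [Pa gsBV rhoE]]] : exists (P : probability T R) (gs : 'I_n -> R -> R),
    [/\ atomless P, (forall i, HBV (gs i)) &
      forall Ys, comonotonic_allocations Ps X Ys ->
        forall i, rho (hs i) (Ps i) (Ys i) = rho (gs i) P (Ys i)].
  exists P, gs; split => // Xs XsA; split=> -[_ Xopt]; split=> // Ys YsA.
    move=> le_rho i; rewrite -!rhoE//; apply: Xopt => // k.
    by rewrite !rhoE.
  move=> le_rho i; rewrite !rhoE//; apply: Xopt => // k.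
  by rewrite -!rhoE.
case: n => [|n] in Ps hs hPs hhs hdens *.
  (* With no agents there is nothing to average, and any atomless probability will do. *)
  by case: hT => P0 P0a; exists P0, hs; split => // Ys _ [].
have [P [P0 PE]] := equivalent_mixture _ _ _ _ Ps.
have Pa : atomless P by exact: atomless_mixture P0 hPs.
pose S (Q : probability T R) y := fine (Q [set w | y < X w]).
have mX y := measurable_superlevel _ _ _ X y.
have S01 Q y : 0 <= S Q y <= 1.
  rewrite /S fine_ge0//= -lee_fin fineK ?fin_num_measure//.
  exact: probability_le1.
have sub y z : y <= z -> [set w | z < X w] `<=` [set w | y < X w].
  by move=> yz w /=; exact: le_lt_trans.
have Shomo Q : {homo S Q : y z / y <= z >-> z <= y}.
  move=> y z yz; rewrite fine_le ?fin_num_measure// le_measure ?inE//; exact: sub.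
have Seq i y z : S P y = S P z -> S (Ps i) y = S (Ps i) z.
  wlog yz : y z / y <= z.
    by move=> W; have [/W//|/ltW/W H /esym/H] := leP y z.
  move=> SPyz.
  congr fine; apply: (dominated_eq_measure _ _ _ P) => //; [|exact: sub|].
    by move=> C /P0 /(_ i).
  by rewrite -[LHS]fineK ?fin_num_measure// -/(S P y) SPyz fineK ?fin_num_measure.
have [M XM] := bounded_fun_norm_le _ _ _ hX.
(* The values at [M] and [- M - 1] force [phi i] to fix [0] and [1]: the first gives [gs i 0 = 0],
   the second preserves the constant [h 1] subtracted in [rho]. The extra [- 1] makes the lower
   bound on [X] strict. *)
have SM Q : S Q M = 0.
  rewrite /S [X in Q X](_ : _ = set0) ?measure0//.
  rewrite -subset0 => w /= Mw.
  by have := lt_le_trans Mw (le_trans (ler_norm _) (XM w)); rewrite ltxx.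
have SNM Q : S Q (- M - 1) = 1.
  rewrite /S [X in Q X](_ : _ = setT) ?probability_setT//.
  rewrite -subTset => w _ /=; have := XM w; rewrite ler_norml => /andP[+ _].
  by apply: lt_le_trans; rewrite ltrBlDr ltrDl.
have /choice[phi phiP] i := homo_factorization R (S P) (S (Ps i)) M
  (S01 (Ps i)) (S01 P) (Shomo (Ps i)) (Seq i) (Shomo P) (SM P).
exists P, (fun i => hs i \o phi i); split => //.
- move=> i; have [phi01 phi_homo phiS] := phiP i; have [hbv h0] := hhs i.
  split; first exact: bounded_variation_comp_homo hbv phi01 phi_homo.
  by rewrite /= -[X in phi i X](SM P) phiS SM.
- move=> Ys YsA i; have [phi01 phi_homo phiS] := phiP i.
  have survE x : hs i (fine (Ps i [set w | x < Ys i w]))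
               = (hs i \o phi i) (fine (P [set w | x < Ys i w])).
    have [y yP] := comonotonic_survival _ _ _ _ Ps X Ys i x hX hdens YsA.
    (* One [y] serves all the [Ps j], so [PE] carries the equality of masses over to [P]. *)
    by rewrite yP (PE _ _ yP) /= -/(S P y) phiS.
  have h1 : (hs i \o phi i) 1 = hs i 1 by rewrite /= -[X in phi i X](SNM P) phiS SNM.
  rewrite /rho h1; congr (_ + _); apply: eq_Rintegral => x _; rewrite survE//.
Qed.
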